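(* Let $A$ be a finite-dimensional alternative algebra over a field of characteristic zero. Then $A$ is nilpotent if and only if $A$ admits an invertible Leibniz-derivation (of some order $n$).
   Context: An algebra is alternative if $(x,x,y)=(x,y,y)=0$ identically, where $(x,y,z)=(xy)z-x(yz)$. $A$ is nilpotent if there is $s$ such that every product of $s$ elements of $A$, in any arrangement of parentheses, is zero. A Leibniz-derivation (in the sense of Moens) of order $n$ of an algebra $A$ is a linear map $\phi:A\to A$ such that for all $x_1,\dots,x_n\in A$, $\phi((\cdots((x_1x_2)x_3)\cdots)x_n)=\sum_{i=1}^n(\cdots((x_1x_2)\cdots\phi(x_i))\cdots)x_n$, i.e. the sum of the left-normed products in which $x_i$ is replaced by $\phi(x_i)$. *)

(* Defs.v *)
From HB Require Import structures.
From mathcomp Require Import all_boot all_order all_algebra.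
Set Implicit Arguments. Unset Strict Implicit. Unset Printing Implicit Defensive.
Import GRing.Theory.
Local Open Scope ring_scope.

Section AlgDefs.
Variables (F : fieldType) (A : vectType F) (mul : A -> A -> A).

Definition bilinear_mul : Prop :=
  (forall (a : F) (x y z : A), mul (a *: x + y) z = a *: mul x z + mul y z) /\
  (forall (a : F) (x y z : A), mul z (a *: x + y) = a *: mul z x + mul z y).

Definition assoc (x y z : A) : A := mul (mul x y) z - mul x (mul y z).

Definition alternative : Prop :=
  forall x y : A, assoc x x y = 0 /\ assoc x y y = 0.

Inductive is_prod : nat -> A -> Prop :=
| is_prod_leaf (a : A) : is_prod 1 a
| is_prod_node (i j : nat) (a b : A) :
    is_prod i a -> is_prod j b -> is_prod (i + j) (mul a b).

Definition nilpotent_alg : Prop :=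
  exists s : nat, (0 < s)%N /\ forall x : A, is_prod s x -> x = 0.

Definition lprod (xs : seq A) : A :=
  match xs with
  | [::] => 0
  | x :: xs' => foldl mul x xs'
  end.

Definition linear_map (phi : A -> A) : Prop :=
  forall (a : F) (x y : A), phi (a *: x + y) = a *: phi x + phi y.

Definition leibniz_derivation (n : nat) (phi : A -> A) : Prop :=
  linear_map phi /\
  forall xs : seq A, size xs = n ->
    phi (lprod xs) =
    \sum_(i < n) lprod (set_nth 0 xs i (phi (nth 0 xs i))).

End AlgDefs.

(* Main.v *)
(* If A is nilpotent, the identity is a Leibniz-derivation of large order.

Conversely, in an alternative algebra the trace form (x, y) |-> tr L_(xy) = tr (L_x L_y)
is symmetric and associative; its radical N is a nil ideal, so tr L vanishes on N and
there is u with tr L_(ux) = tr L_x, i.e. a unit modulo N. Taking the trace of [phi,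
L_(x_1 ... x_(n-1))] shows that tr L_(x_1 ... x_(n-1)) is phi-invariant; with x_1 in N
and x_3 = ... = u this gives phi(N) = N when n > 2. Then phi(u) = phi(u^n) = n phi(u)
modulo N, so phi(u), hence u, lies in N and tr L = 0; for n = 2 this is immediate from
tr L_(phi x) = 0. Thus A is nil. A nil alternative algebra is nilpotent by enlarging,
one generator at a time, a subalgebra whose multiplication operators act nilpotently on
A. *)
Require Import Defs.
From HB Require Import structures.
From mathcomp Require Import all_boot all_order all_algebra.
From mathcomp Require Import ring.
Import GRing.Theory VectorInternalTheory.
Local Open Scope ring_scope.

(** * Matrices with vanishing power traces *)

Lemma mulmx_expC (R : pzRingType) (m n : nat) (C : 'M[R]_(m, n)) (D : 'M[R]_(n, m)) k :
  (C *m D) ^+ k.+1 = C *m (D *m C) ^+ k *m D.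
Proof.
elim: k => [|k IHk]; first by rewrite expr1 expr0 mulmx1.
by rewrite exprS -mulmxE IHk [(D *m C) ^+ _.+1]exprS -mulmxE !mulmxA.
Qed.

(* The factorization M = C D through the row space, of size r = rank M, passes from M to
D C, which has the same power traces and smaller size; for M invertible, taking traces
in Cayley-Hamilton would give n * det M = 0. *)
Lemma trace_expr_nilpotent (F : fieldType) n (M : 'M[F]_n) :
  [pchar F] =i pred0 -> (forall k, \tr (M ^+ k.+2) = 0) ->
  \tr M = 0 /\ exists k, M ^+ k = 0.
Proof.
move=> charF; elim/ltn_ind: n M => n IHn M trM.
have [ltrn|lenr] := ltnP (\rank M) n.
  have := mulmx_base M; set C := col_base M; set D := row_base M => defM.
  have [k|trDC [k DCk]] := IHn _ ltrn (D *m C).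
    rewrite mulmx_expC defM -mulmxA mxtrace_mulC -mulmxA defM.
    by rewrite mulmxE -exprSr.
  split; first by rewrite -defM mxtrace_mulC.
  by exists k.+1; rewrite -defM mulmx_expC DCk mulmx0 mul0mx.
case: n => [|n] in IHn M trM lenr *.
  by split; [rewrite /mxtrace big_ord0 | exists 0%N; rewrite [LHS]flatmx0 [RHS]flatmx0].
have Mu : M \in unitmx by rewrite -row_full_unit /row_full eqn_leq rank_leq_row.
set p := char_poly M.
have p0 : p`_0 != 0.
  by rewrite char_poly_det mulf_neq0 ?signr_eq0 // -unitfE -unitmxE.
have sum0 j : p`_0 * \tr (M ^+ j) + \sum_(i < n.+1) p`_i.+1 * \tr (M ^+ (i.+1 + j)) = 0.
  have := congr1 (fun N => \tr (N * M ^+ j)) (Cayley_Hamilton M).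
  rewrite mul0r mxtrace0 -/p -[p in horner_mx _ p]coefK poly_def size_char_poly.
  rewrite rmorph_sum mulr_suml raddf_sum big_ord_recl /= => sum0.
  rewrite -[RHS]sum0; congr (_ + _).
    by rewrite expr0 alg_polyC horner_mx_C -mulmxE mul_scalar_mx mxtraceZ.
  apply: eq_bigr => i _.
  by rewrite linearZ /= rmorphXn /= horner_mx_X -scalerAl mxtraceZ -exprD.
have trM1 : \tr M = 0.
  apply/eqP; have /eqP := sum0 1%N; rewrite expr1 big1 ?addr0 => [|i _].
    by rewrite mulf_eq0 (negPf p0).
  by rewrite addn1 trM mulr0.
have /eqP := sum0 0%N; rewrite big1 ?addr0 => [|i _].
  rewrite expr0 mxtrace1 mulf_eq0 (negPf p0) /=.
  by move/pcharf0P: charF => ->.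
by rewrite addn0; case: {+}(i : nat) => [|k]; rewrite ?expr1 ?trM1 ?trM mulr0.
Qed.

(** * Traces of endomorphisms *)

Section LinearTrace.
Set Implicit Arguments.
Unset Strict Implicit.
Variables (F : fieldType) (A : vectType F).
Implicit Types f g : 'End(A).

Lemma v2r_lfun f x : v2r (f x) = v2r x *m f2mx f.
Proof. by rewrite unlock /= r2vK. Qed.

Definition lftrace f : F := \tr (f2mx f).

Lemma f2mx_comp f g : f2mx (f \o g)%VF = f2mx g *m f2mx f.
Proof.
apply/row_matrixP => i; rewrite !rowE mulmxA.
by rewrite -[delta_mx 0 i]r2vK -!v2r_lfun comp_lfunE.
Qed.

Fact lftrace_is_linear : scalar lftrace.
Proof.
move=> a f g; rewrite /lftrace -mxtraceZ -mxtraceD; congr (\tr _).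
apply/row_matrixP => i; rewrite !rowE mulmxDr -scalemxAr -[delta_mx 0 i]r2vK.
by rewrite -!v2r_lfun add_lfunE scale_lfunE linearP.
Qed.
HB.instance Definition _ := GRing.isLinear.Build F 'End(A) F *%R lftrace lftrace_is_linear.

Lemma lftraceC f g : lftrace (f \o g)%VF = lftrace (g \o f)%VF.
Proof. by rewrite /lftrace !f2mx_comp mxtrace_mulC. Qed.

End LinearTrace.

(** * Nilpotent families of operators *)

Section OperatorAction.
Set Implicit Arguments.
Unset Strict Implicit.
Variables (F : fieldType) (A : vectType F).
Implicit Types (S P Q : seq 'End(A)) (U V W : {vspace A}) (f g : 'End(A)).

Definition act S V : {vspace A} := (\sum_(f <- S) (f @: V))%VS.

Lemma act_mem S V f v : f \in S -> v \in V -> f v \in act S V.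
Proof.
move=> fS vV; rewrite /act (big_rem f) //=.
by apply: (subvP (addvSl _ _)); apply: memv_img.
Qed.

Lemma act_subP S V W :
  reflect (forall f v, f \in S -> v \in V -> f v \in W) (act S V <= W)%VS.
Proof.
apply: (iffP idP) => [sSW f v fS vV|SW]; first exact/(subvP sSW)/act_mem.
rewrite /act big_seq; elim/big_ind: _ => [|U1 U2 sU1 sU2|f fS].
- exact: sub0v.
- by rewrite subv_add sU1.
by apply/subvP => _ /memv_imgP[v vV ->]; apply: SW.
Qed.

Lemma memv_act S V W f x : (forall g v, g \in S -> v \in V -> f (g v) \in W) ->
  x \in act S V -> f x \in W.
Proof.
move=> fSW; rewrite memv_preim; apply: (subvP _); apply/act_subP => g v gS vV.
by rewrite -memv_preim; apply: fSW.
Qed.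

Lemma actS S U V : (U <= V)%VS -> (act S U <= act S V)%VS.
Proof. by move=> /subvP sUV; apply/act_subP => f v fS /sUV; apply: act_mem. Qed.

Lemma act_cat P Q V : act (P ++ Q) V = (act P V + act Q V)%VS.
Proof. by rewrite /act big_cat. Qed.

Lemma actD S U V : act S (U + V)%VS = (act S U + act S V)%VS.
Proof. by rewrite /act -big_split; apply: eq_bigr => f _; rewrite limgD. Qed.

(** All words of some fixed length [k] in [S] vanish; stated through images so that chains of
    subspaces can be used. *)
Definition nilpotent_ops S : Prop := exists k, iter k (act S) fullv = 0%VS.

Lemma nilpotent_ops1 f k : (forall x, iter k f x = 0) -> nilpotent_ops [:: f].
Proof.
move=> fk; exists k; apply/eqP; rewrite -subv0.
suff fkV j V W : (forall v, v \in V -> iter j f v \in W) -> (iter j (act [:: f]) V <= W)%VS.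
  by apply: fkV => v _; rewrite fk mem0v.
elim: j V => [|j IHj] V fW; first exact/subvP.
rewrite iterSr; apply: IHj => v; rewrite /act big_seq1 => /memv_imgP[w wV ->].
by rewrite -iterSr fW.
Qed.

(* The spaces P^j A are Q-stable, and Q^m kills P^j A modulo P^(j+1) A. *)
Lemma nilpotent_ops_cat P Q :
  (forall V, (act Q (act P V) <= act P (V + act Q V))%VS) ->
  nilpotent_ops P -> nilpotent_ops Q -> nilpotent_ops (Q ++ P).
Proof.
move=> QP [r Pr] [m Qm]; pose V j := iter j (act P) fullv.
have QV j : (act Q (V j) <= V j)%VS.
  elim: j => [|j IHj]; first exact: subvf.
  by apply: subv_trans (QP _) _; apply: actS; rewrite subv_add subvv.
have VS j : (V j.+1 <= V j)%VS.
  by elim: j => [|j IHj]; [apply: subvf | apply: actS].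
(* One use of [P] already lands in [V j.+1], so modulo that space only words in [Q] survive. *)
have stepV i j : (iter i (act (Q ++ P)) (V j) <= iter i (act Q) (V j) + V j.+1)%VS.
  elim: i => [|i IHi]; first exact: addvSl.
  have iQV : (iter i (act Q) (V j) <= V j)%VS.
    elim: i {IHi} => [|i IHi]; [exact: subvv | exact: (subv_trans (actS Q IHi) (QV j))].
  apply: (subv_trans (actS _ IHi)); rewrite act_cat !actD !subv_add -!andbA.
  rewrite addvSl (subv_trans (QV _) (addvSr _ _)).
  rewrite (subv_trans (actS _ iQV) (addvSr _ _)).
  by rewrite (subv_trans (actS _ (VS j)) (addvSr _ _)).
have iterS k S (U W : {vspace A}) : (U <= W)%VS -> (iter k (act S) U <= iter k (act S) W)%VS.
  by move=> sUW; elim: k => //= k IHk; exact: actS.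
exists (r * m)%N; apply/eqP; rewrite -subv0 -Pr -/(V r).
elim: {Pr} r => [|r IHr]; first exact: subvf.
rewrite mulSn iterD; apply: (subv_trans (iterS _ _ _ _ IHr)).
apply: (subv_trans (stepV m r)); rewrite subv_add subvv andbT.
by apply: (subv_trans (iterS _ _ _ _ (subvf _))); rewrite Qm sub0v.
Qed.

End OperatorAction.

(** * Bilinear and left-normed products *)

Section BilinearMul.
Set Implicit Arguments.
Unset Strict Implicit.
Variables (F : fieldType) (A : vectType F) (mul : A -> A -> A).
Hypothesis mulB : bilinear_mul mul.
Local Notation "x ** y" := (mul x y) (at level 40, left associativity).

Fact mull_is_linear x : linear (mul x).
Proof. by move=> a y z; apply: mulB.2. Qed.
Fact mulr_is_linear x : linear (mul^~ x).
Proof. by move=> a y z; apply: mulB.1. Qed.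

Definition lmulL x : 'End(A) := linfun (HB.pack_for {linear A -> A} (mul x)
  (GRing.isLinear.Build F A A *:%R (mul x) (mull_is_linear x))).
Definition lmulR x : 'End(A) := linfun (HB.pack_for {linear A -> A} (mul^~ x)
  (GRing.isLinear.Build F A A *:%R (mul^~ x) (mulr_is_linear x))).

Lemma lmulLE x y : lmulL x y = x ** y. Proof. exact: lfunE. Qed.
Lemma lmulRE x y : lmulR x y = y ** x. Proof. exact: lfunE. Qed.

Lemma amulDl x y z : (x + y) ** z = x ** z + y ** z.
Proof. by rewrite -!lmulRE linearD. Qed.
Lemma amulDr x y z : z ** (x + y) = z ** x + z ** y.
Proof. by rewrite -!lmulLE linearD. Qed.
Lemma amulNl x y : (- x) ** y = - (x ** y).
Proof. by rewrite -!lmulRE linearN. Qed.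
Lemma amulZl a x y : (a *: x) ** y = a *: (x ** y).
Proof. by rewrite -!lmulRE linearZ. Qed.
Lemma amulZr a x y : x ** (a *: y) = a *: (x ** y).
Proof. by rewrite -!lmulLE linearZ. Qed.
Lemma amul0l x : 0 ** x = 0. Proof. by rewrite -lmulRE linear0. Qed.
Lemma amul0r x : x ** 0 = 0. Proof. by rewrite -lmulLE linear0. Qed.

Fact lmulL_is_linear : linear lmulL.
Proof.
move=> a x y; apply/lfunP => z.
by rewrite add_lfunE scale_lfunE !lmulLE amulDl amulZl.
Qed.
HB.instance Definition _ := GRing.isLinear.Build F A 'End(A) *:%R lmulL lmulL_is_linear.

Lemma lprod_rcons s y : s != [::] -> lprod mul (rcons s y) = lprod mul s ** y.
Proof. by case: s => // x s _; rewrite /= -cats1 foldl_cat. Qed.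

Lemma is_prod_lprod x s : is_prod mul (size s).+1 (lprod mul (x :: s)).
Proof.
elim/last_ind: s => [|s y IHs]; first exact: is_prod_leaf.
rewrite -rcons_cons lprod_rcons // size_rcons -addn1.
exact/is_prod_node/is_prod_leaf.
Qed.

Lemma nilpotent_lprod_eq0 s : (0 < s)%N -> (forall x, is_prod mul s x -> x = 0) ->
  forall xs, size xs = s.+1 -> lprod mul xs = 0.
Proof.
move=> s_gt0 prod0; case/lastP => // xs y; rewrite size_rcons => -[sz].
case: xs sz => [|x xs] sz; first by rewrite -sz in s_gt0.
rewrite lprod_rcons // [lprod _ _]prod0 ?amul0l // -sz.
exact: is_prod_lprod.
Qed.

(** * Identities of alternative algebras *)

Section Alternative.
Hypothesis altA : alternative mul.

Lemma v2r_eqP (x y : A) : (forall i, v2r x 0 i = v2r y 0 i) -> x = y.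
Proof. by move=> E; apply: v2r_inj; apply/rowP. Qed.

Lemma v2rDE (x y : A) i : v2r (x + y) 0 i = v2r x 0 i + v2r y 0 i.
Proof. by rewrite linearD mxE. Qed.
Lemma v2rNE (x : A) i : v2r (- x) 0 i = - v2r x 0 i.
Proof. by rewrite linearN mxE. Qed.
Lemma v2r0E i : v2r (0 : A) 0 i = 0.
Proof. by rewrite linear0 mxE. Qed.

(** Additive identities in [A] are checked coordinatewise, with coordinates as atoms of [F], so that
    [ring] applies although [A] is not a ring. *)
Ltac zmod_ring :=
  apply: v2r_eqP => ?; rewrite ?(v2rDE, v2rNE, v2r0E);
  repeat (match goal with |- context [fun_of_matrix (v2r ?a) ?b ?c] =>
    move: (fun_of_matrix (v2r a) b c) => ? end);
  ring.

(** Linearization of (x,x,z) = 0, solved for x(yz) so that it can serve as a rewriting rule. *)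
Lemma lalt_lin x y z : x ** (y ** z) = (x ** y) ** z + (y ** x) ** z - y ** (x ** z).
Proof.
have /subr0_eq := (altA (x + y) z).1.
have /subr0_eq := (altA x z).1; have /subr0_eq := (altA y z).1.
rewrite !(amulDl, amulDr) => -> -> /eqP; rewrite -subr_eq0 => /eqP E.
apply/eqP; rewrite -subr_eq0 -oppr_eq0 -[eqbRHS]E; apply/eqP.
zmod_ring.
Qed.

Lemma ralt_lin x y z : (x ** y) ** z = x ** (y ** z) + x ** (z ** y) - (x ** z) ** y.
Proof.
have /subr0_eq := (altA x (y + z)).2.
have /subr0_eq := (altA x y).2; have /subr0_eq := (altA x z).2.
rewrite !(amulDl, amulDr) => -> -> /eqP; rewrite -subr_eq0 => /eqP E.
apply/eqP; rewrite -subr_eq0 -[eqbRHS]E; apply/eqP.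
zmod_ring.
Qed.

Lemma flexible x y : (x ** y) ** x = x ** (y ** x).
Proof.
have /subr0_eq := (altA y x).2; have := ralt_lin x y x.
rewrite (subr0_eq (altA x y).1) => -> _; zmod_ring.
Qed.

(** Nilness is expressed by iterated squares: the alternative laws directly turn multiplication by
    x^(2^k) into 2^k multiplications by x. *)
Definition sqr x := x ** x.

Lemma iter_sqr_mull k x v : iter k sqr x ** v = iter (2 ^ k) (mul x) v.
Proof.
elim: k v => [|k IHk] v //=.
by rewrite /sqr (subr0_eq (altA _ v).1) !IHk expnS mul2n -addnn iterD.
Qed.

Lemma iter_sqr_mulr k x v : v ** iter k sqr x = iter (2 ^ k) (mul^~ x) v.
Proof.
elim: k v => [|k IHk] v //=.
by rewrite /sqr -(subr0_eq (altA v _).2) !IHk expnS mul2n -addnn iterD.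
Qed.

(** * Nil alternative algebras are nilpotent *)

Definition mult_ops (s : seq A) : seq 'End(A) :=
  flatten [seq [:: lmulL x; lmulR x] | x <- s].

Lemma mult_opsP s f :
  reflect (exists2 x, x \in s & f = lmulL x \/ f = lmulR x) (f \in mult_ops s).
Proof.
apply: (iffP flatten_mapP) => [[x xs]|[x xs fx]].
  by rewrite !inE => /orP fx; exists x => //; case: fx => /eqP; [left|right].
by exists x => //; rewrite !inE; case: fx => ->; rewrite eqxx ?orbT.
Qed.

Lemma mull_act s (V : {vspace A}) b v : b \in <<s>>%VS -> v \in V -> b ** v \in act (mult_ops s) V.
Proof.
move=> bs vV; rewrite -lmulRE memv_preim; apply: (subvP _) bs; apply/span_subvP => x xs.
by rewrite -memv_preim lmulRE -lmulLE; apply: act_mem => //; apply/mult_opsP; exists x; auto.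
Qed.

Lemma mulr_act s (V : {vspace A}) b v : b \in <<s>>%VS -> v \in V -> v ** b \in act (mult_ops s) V.
Proof.
move=> bs vV; rewrite -lmulLE memv_preim; apply: (subvP _) bs; apply/span_subvP => x xs.
by rewrite -memv_preim lmulLE -lmulRE; apply: act_mem => //; apply/mult_opsP; exists x; auto.
Qed.

(** By flexibility L_y and R_y commute, and each has vanishing 2^k-th power because y^(2^k) = 0. *)
Lemma mult_ops1_nilpotent y k : iter k sqr y = 0 -> nilpotent_ops (mult_ops [:: y]).
Proof.
move=> yk; apply: (@nilpotent_ops_cat _ _ [:: lmulR y] [:: lmulL y]).
- move=> V; apply/act_subP => f w; rewrite inE => /eqP ->.
  apply: memv_act => g v; rewrite inE => /eqP -> vV.
  rewrite lmulLE lmulRE -flexible -[y ** v]lmulLE -lmulRE.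
  apply: act_mem; rewrite ?inE //; apply: (subvP (addvSr _ _)).
  by apply: act_mem; rewrite ?inE.
- apply: (@nilpotent_ops1 _ _ _ (2 ^ k)) => x; rewrite -[RHS](amul0r x) -yk iter_sqr_mulr.
  exact/eq_iter/lmulRE.
- apply: (@nilpotent_ops1 _ _ _ (2 ^ k)) => x; rewrite -[RHS](amul0l x) -yk iter_sqr_mull.
  exact/eq_iter/lmulLE.
Qed.

Definition normalizes (B : {vspace A}) y :=
  forall b, b \in B -> b ** y \in B /\ y ** b \in B.

(** The linearized laws move y inside an operator of b in [<<s>>], as in y(bv) = (yb)v + (by)v -
    b(yv); since yb and by stay in [<<s>>], the criterion [nilpotent_ops_cat] applies. *)
Lemma mult_ops_cons_nilpotent s y k : iter k sqr y = 0 -> normalizes <<s>>%VS y ->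
  nilpotent_ops (mult_ops s) -> nilpotent_ops (mult_ops (y :: s)).
Proof.
move=> yk yB nils; apply: (@nilpotent_ops_cat _ _ (mult_ops s) (mult_ops [:: y])) => //; last first.
  exact: mult_ops1_nilpotent yk.
move=> V; apply/act_subP => f w fy; apply: memv_act => g v /mult_opsP[b bs gb] vV.
have bB : b \in <<s>>%VS by apply: memv_span.
have [byB ybB] := yB b bB.
have vVy : v \in (V + act (mult_ops [:: y]) V)%VS by apply: (subvP (addvSl _ _)).
have yB1 : y \in <<[:: y]>>%VS by apply/memv_span/mem_head.
have yvV : y ** v \in (V + act (mult_ops [:: y]) V)%VS.
  by apply: (subvP (addvSr _ _)); apply: mull_act.
have vyV : v ** y \in (V + act (mult_ops [:: y]) V)%VS.
  by apply: (subvP (addvSr _ _)); apply: mulr_act.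
case/mult_opsP: fy => _ /[1!inE] /eqP-> [] ->; case: gb => ->; rewrite ?lmulLE ?lmulRE.
- by rewrite lalt_lin; apply: rpredB; [apply: rpredD|]; first [exact: mull_act | exact: mulr_act].
- by rewrite lalt_lin; apply: rpredB; [apply: rpredD|]; first [exact: mull_act | exact: mulr_act].
- by rewrite ralt_lin; apply: rpredB; [apply: rpredD|]; first [exact: mull_act | exact: mulr_act].
- by rewrite ralt_lin; apply: rpredB; [apply: rpredD|]; first [exact: mull_act | exact: mulr_act].
Qed.

Definition mul_closed (B : {vspace A}) := forall x y, x \in B -> y \in B -> x ** y \in B.

Lemma mul_closed_cons s y : mul_closed <<s>>%VS -> normalizes <<s>>%VS y ->
  sqr y \in <<s>>%VS -> mul_closed <<y :: s>>%VS.
Proof.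
rewrite span_cons => sB yB y2B x1 x2 /memv_addP[_ /vlineP[a ->] [b bB ->]].
move=> /memv_addP[_ /vlineP[c ->] [d dB ->]].
apply: (subvP (addvSr _ _)).
rewrite amulDl !amulDr !amulZl !amulZr.
have [byB ybB] := yB b bB; have [dyB ydB] := yB d dB.
by do ![apply: rpredD | apply: rpredZ]; rewrite // sB.
Qed.

(* x is taken in the last space (mult_ops s)^j A not contained in <<s>>, and y is the last
iterated square of x outside <<s>>. *)
Lemma exists_normalizing s : mul_closed <<s>>%VS -> nilpotent_ops (mult_ops s) ->
  <<s>>%VS != fullv -> (forall x, exists k, iter k sqr x = 0) ->
  exists2 y, y \notin <<s>>%VS & normalizes <<s>>%VS y /\ sqr y \in <<s>>%VS.
Proof.
set B := <<s>>%VS => cB [r Br] nfB nil; pose V j := iter j (act (mult_ops s)) fullv.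
have exj : exists j, (V j <= B)%VS by exists r; rewrite /V Br sub0v.
have [[|j] VjB minj] := ex_minnP exj; first by rewrite eqEsubv subvf VjB in nfB.
have /subvPn[x xV xB] : ~~ (V j <= B)%VS by apply/negP => /minj; rewrite ltnn.
have xN : normalizes B x.
  by move=> b bB; split; apply: (subvP VjB); [apply: mull_act | apply: mulr_act].
have [k xk] := nil x.
have exm : exists m, iter m sqr x \in B by exists k; rewrite xk mem0v.
have [[|m] xmB minm] := ex_minnP exm; first by rewrite xmB in xB.
exists (iter m sqr x); first by apply/negP => /minm; rewrite ltnn.
(* Multiplying by a square is multiplying twice, so normalizing survives squaring. *)
split=> //; elim: m {xmB minm} => //= m IHm b bB.
have [bxB xbB] := IHm b bB; split.
  by rewrite /sqr -(subr0_eq (altA b _).2); case: (IHm _ bxB).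
by rewrite /sqr (subr0_eq (altA _ b).1); case: (IHm _ xbB).
Qed.

Lemma mult_ops_nilpotent : (forall x, exists k, iter k sqr x = 0) ->
  exists2 s, <<s>>%VS = fullv & nilpotent_ops (mult_ops s).
Proof.
move=> nil.
suff [s fs [_ ns]] : exists2 s, <<s>>%VS = fullv &
    mul_closed <<s>>%VS /\ nilpotent_ops (mult_ops s).
  by exists s.
have: mul_closed <<[::]>>%VS /\ nilpotent_ops (mult_ops [::]).
  split; last by exists 1%N; rewrite /= /act big_nil.
  by move=> x y; rewrite span_nil !memv0 => /eqP-> _; rewrite amul0l.
(* Induction on the codimension of the subalgebra [<<s>>], starting from zero. *)
move: [::] => s; have [d] := ubnP (\dim {:A} - \dim <<s>>).
elim: d s => // d IHd s ltd [cs ns].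
have [fs|nfs] := eqVneq <<s>>%VS fullv; first by exists s.
have [y ys [yN y2]] := exists_normalizing cs ns nfs nil.
apply: (IHd (y :: s)); last first.
  by split; [apply: mul_closed_cons | have [k yk] := nil y; apply: mult_ops_cons_nilpotent yk _ _].
move: ltd; rewrite ltnS; apply: leq_trans.
have ltD : (\dim <<s>> < \dim <<y :: s>>)%N.
  rewrite ltn_neqAle dimvS ?span_cons ?addvSr // andbT.
  apply: contra ys => eqd.
  have /eqP -> : <<s>>%VS == (<[y]> + <<s>>)%VS by rewrite eqEdim addvSr (eqP eqd) /=.
  by apply: (subvP (addvSl _ _)); rewrite memv_line.
by apply: ltn_sub2l; first exact: leq_trans ltD (dimvS (subvf _)).
Qed.

(** In a product of at least 2^(k+1) factors, one of the two sides has at least 2^k; the other side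
    counts as a single multiplication operator. *)
Lemma is_prod_act s k m x : <<s>>%VS = fullv -> is_prod mul m x -> (2 ^ k <= m)%N ->
  x \in iter k (act (mult_ops s)) fullv.
Proof.
move=> fs px; elim: px k => [a|i j a b _ IHa _ IHb] [|k]; rewrite ?memvf // => lek.
  by rewrite leqNgt (@leq_trans (2 ^ k.+1)) ?(ltn_exp2l 0) // in lek.
have [lei|lti] := leqP (2 ^ k) i.
  by apply: mulr_act; rewrite ?fs ?memvf ?IHa.
apply: mull_act; rewrite ?fs ?memvf // IHb // -(leq_add2l i).
by apply: leq_trans lek; rewrite expnS mul2n -addnn leq_add2r ltnW.
Qed.

Lemma nil_nilpotent : (forall x, exists k, iter k sqr x = 0) -> nilpotent_alg mul.
Proof.
move=> /mult_ops_nilpotent[s fs [k nk]]; exists (2 ^ k)%N; split=> [|x px].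
  by rewrite expn_gt0.
by apply/eqP; rewrite -memv0 -nk; apply: is_prod_act px _.
Qed.

(** * The trace form and its radical *)

Section Trace.
Hypothesis charF : [pchar F] =i pred0.

Lemma natr_neq0 k : k.+1%:R != 0 :> F.
Proof. by move/pcharf0P: charF => ->. Qed.

Lemma rpow_comm k x : iter k (mul x) x ** x = x ** iter k (mul x) x.
Proof. by elim: k => //= k IHk; rewrite flexible IHk. Qed.

(** [iter k (mul x) x] is p = x^(k+1). As p commutes with x, the linearized left law gives x(pv) +
    p(xv) = 2(xp)v, and 2 is cancelled. *)
Lemma rpow_mul k x v : iter k (mul x) x ** v = iter k.+1 (mul x) v.
Proof.
elim: k v => [|k IHk] v //.
set p := iter k (mul x) x; set w := iter k.+2 (mul x) v.
have: x ** (p ** v) + p ** (x ** v) = 2%:R *: (x ** p ** v).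
  by rewrite lalt_lin rpow_comm subrK scaler_nat mulr2n.
rewrite !IHk -[iter k.+1 _ (x ** v)]iterSr -/w -mulr2n -scaler_nat.
by move/(scalerI (natr_neq0 1)).
Qed.

Definition trL x : F := lftrace (lmulL x).

Fact trL_is_linear : scalar trL.
Proof. by move=> a x y; rewrite /trL !linearP. Qed.
HB.instance Definition _ := GRing.isLinear.Build F A F *%R trL trL_is_linear.

Lemma f2mx_rpow k x : f2mx (lmulL (iter k (mul x) x)) = f2mx (lmulL x) ^+ k.+1.
Proof.
elim: k => [|k IHk]; first by rewrite expr1.
rewrite exprSr -IHk -mulmxE -f2mx_comp; congr f2mx; apply/lfunP => v.
by rewrite comp_lfunE !lmulLE !rpow_mul.
Qed.

Lemma trL_rpow_eq0 x : (forall k, trL (x ** iter k (mul x) x) = 0) ->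
  trL x = 0 /\ exists k, iter k sqr x = 0.
Proof.
move=> trx; have [k|tr0 [k xk]] := @trace_expr_nilpotent _ _ (f2mx (lmulL x)) charF.
  by rewrite -f2mx_rpow; apply: trx.
split=> //; exists k.+1.
(* x^(2^(k+1)) is L_x^(2^k) applied to x^(2^k), and L_x^k = 0. *)
have lek : (k <= 2 ^ k)%N by rewrite ltnW // ltn_expl.
rewrite /= /sqr iter_sqr_mull; move: (iter k sqr x) => y.
apply: v2r_inj; rewrite linear0 -(subnKC lek) iterD.
have v2r_iter j z : v2r (iter j (mul x) z) = v2r z *m f2mx (lmulL x) ^+ j.
  elim: j => [|j IHj]; first by rewrite expr0 mulmx1.
  by rewrite iterS -lmulLE v2r_lfun IHj -mulmxA mulmxE -exprSr.
by rewrite v2r_iter xk mulmx0.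
Qed.

(** L_(xy) = L_x L_y + [L_x, R_y], and a commutator has trace zero. *)
Lemma trL_mul x y : trL (x ** y) = lftrace (lmulL x \o lmulL y)%VF.
Proof.
have -> : trL (x ** y) = lftrace ((lmulL x \o lmulL y) +
    ((lmulL x \o lmulR y) - (lmulR y \o lmulL x)))%VF.
  congr lftrace; apply/lfunP => z.
  rewrite !(add_lfunE, opp_lfunE, comp_lfunE, lmulLE, lmulRE) (ralt_lin x y z).
  zmod_ring.
by rewrite linearD linearB /= [lftrace (lmulR y \o _)%VF]lftraceC subrr addr0.
Qed.

Lemma trL_mulC x y : trL (x ** y) = trL (y ** x).
Proof. by rewrite !trL_mul lftraceC. Qed.

(** By [trL_mulC] the claim is cyclic invariance of trL((xy)z). The linearized laws relate its
    values at the six permutations of x, y, z; a combination of these relations gives 3(e1 - e2) =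
    0. *)
Lemma trL_mulA x y z : trL (x ** y ** z) = trL (x ** (y ** z)).
Proof.
have L a b c : trL (b ** c ** a) + trL (a ** c ** b) - (trL (a ** b ** c) + trL (b ** a ** c)) = 0.
  rewrite ![trL (_ ** _ ** a)]trL_mulC ![trL (_ ** _ ** b)]trL_mulC -!linearD -linearB /=.
  by rewrite lalt_lin subrK subrr linear0.
have R a b c : trL (a ** b ** c) + trL (a ** c ** b) - (trL (b ** c ** a) + trL (c ** b ** a)) = 0.
  rewrite -!linearD /= ralt_lin subrK linearD /= !(trL_mulC a) -linearD /=.
  by rewrite linearD /= subrr.
rewrite [RHS]trL_mulC; apply: subr0_eq; apply: (mulfI (natr_neq0 2)).
have := (L x y z, L y z x, R x y z, R y z x).
set e1 := trL (x ** y ** z); set e2 := trL (y ** z ** x).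
set e3 := trL (z ** x ** y); set o1 := trL (y ** x ** z).
set o2 := trL (x ** z ** y); set o3 := trL (z ** y ** x).
move=> [[[L1 L2] R1] R2]; rewrite mulr0.
transitivity ((e1 + o2 - (e2 + o3)) - (e2 + o2 - (e1 + o1)) - (e2 + o2 - (e1 + o1))
  - (e3 + o1 - (e2 + o3)) - (e2 + o1 - (e3 + o2))); first by ring.
by rewrite L1 L2 R1 R2 !subr0.
Qed.

Definition trform x : 'Hom(A, F^o) :=
  (linfun (HB.pack_for {linear A -> F^o} trL
    (GRing.isLinear.Build F A F^o *:%R trL trL_is_linear)) \o lmulL x)%VF.

Lemma trformE x y : trform x y = trL (x ** y).
Proof. by rewrite comp_lfunE lmulLE lfunE. Qed.

Fact trform_is_linear : linear trform.
Proof.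
move=> a x y; apply/lfunP => z.
by rewrite add_lfunE scale_lfunE !trformE amulDl amulZl linearP.
Qed.
HB.instance Definition _ := GRing.isLinear.Build F A 'Hom(A, F^o) *:%R trform trform_is_linear.

Definition trrad : {vspace A} := lker (linfun trform).

Lemma trradP x : reflect (forall y, trL (x ** y) = 0) (x \in trrad).
Proof.
rewrite memv_ker lfunE /=; apply: (iffP eqP) => [x0 y|x0].
  by rewrite -trformE x0 zero_lfunE.
by apply/lfunP => y; rewrite zero_lfunE trformE.
Qed.

(** Associativity of the form moves y to the other argument. *)
Lemma trrad_mulr x y : x \in trrad -> x ** y \in trrad.
Proof. by move=> /trradP Nx; apply/trradP => z; rewrite trL_mulA Nx. Qed.

Lemma trrad_nil x : x \in trrad -> trL x = 0 /\ exists k, iter k sqr x = 0.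
Proof. by move=> /trradP Nx; apply: trL_rpow_eq0. Qed.

(* trL vanishes on the radical of the symmetric form trL (x ** y), so it lies in the
image of the Gram matrix. *)
Lemma exists_trunit : exists u, forall x, trL (u ** x) = trL x.
Proof.
pose e i := r2v (delta_mx 0 i) : A.
pose G := \matrix_(i, j) trL (e i ** e j); pose c := \row_i trL (e i).
have r2vE v : r2v v = \sum_i v 0 i *: e i.
  by rewrite [in LHS](row_sum_delta v) linear_sum; apply: eq_bigr => i _; rewrite linearZ.
have GE v : v *m G = \row_j trL (r2v v ** e j).
  apply/rowP => j; rewrite !mxE r2vE -lmulRE !linear_sum; apply: eq_bigr => i _ /=.
  by rewrite !linearZ /= lmulRE mxE.
have GT : G^T = G by apply/matrixP => i j; rewrite !mxE trL_mulC.
(* Each column of the cokernel, transposed to [v], satisfies v G = 0 by symmetry of [G]; it lies in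
   the radical, where [trL] vanishes. *)
have cK : c *m cokermx G = 0.
  apply: trmx_inj; rewrite trmx_mul trmx0; apply/row_matrixP => i; rewrite row_mul row0.
  set v := row i _.
  have vG : v *m G = 0.
    by rewrite -row_mul -[in X in _ *m X]GT -trmx_mul mulmx_coker trmx0 row0.
  have Nv : r2v v \in trrad.
    apply/trradP => y; rewrite -[y]v2rK r2vE -lmulLE !linear_sum big1 // => j _.
    rewrite !linearZ /= lmulLE.
    by have /rowP/(_ j) := GE v; rewrite vG !mxE => <-; rewrite mulr0.
  apply/rowP => j; rewrite ord1 !mxE -[RHS](trrad_nil Nv).1 r2vE linear_sum.
  by apply: eq_bigr => k _; rewrite linearZ !mxE.
have /submxP[w cw] : (c <= G)%MS by rewrite submxE cK.
exists (r2v w) => x; rewrite -[x]v2rK r2vE -lmulLE !linear_sum; apply: eq_bigr => i _ /=.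
rewrite !linearZ /= lmulLE; congr (_ * _).
by have /rowP/(_ i) := cw; rewrite GE !mxE.
Qed.

(** * Invertible Leibniz-derivations and the trace *)

Section LeibnizDerivation.
Variables (phi : 'End(A)) (u : A).
Hypothesis phi_inj : lker phi == 0%VS.
Hypothesis uE : forall x, trL (u ** x) = trL x.

Lemma mul_trunit_l x : u ** x - x \in trrad.
Proof.
by apply/trradP => y; rewrite amulDl amulNl linearB /= trL_mulA uE subrr.
Qed.

Lemma mul_trunit_r x : x ** u - x \in trrad.
Proof.
apply/trradP => y; rewrite amulDl amulNl linearB /=.
by rewrite trL_mulC -trL_mulA trL_mulC uE trL_mulC subrr.
Qed.

Lemma foldl_trunit x k : foldl mul x (nseq k u) - x \in trrad.
Proof.
elim: k x => [|k IHk] x /=; first by rewrite subrr mem0v.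
by rewrite -(subrKA (x ** u)) rpredD ?IHk ?mul_trunit_r.
Qed.

Lemma foldl_trrad x s : x \in trrad -> foldl mul x s \in trrad.
Proof. by elim: s x => //= y s IHs x Nx; rewrite IHs ?trrad_mulr. Qed.

(** Before [a] enters, the running product stays congruent to [u] and so acts as a unit on [a];
    later factors [u] keep the class of [a]. *)
Lemma foldl_trunit_set x a k i : x - u \in trrad -> (i < k)%N ->
  foldl mul x (set_nth 0 (nseq k u) i a) - a \in trrad.
Proof.
elim: k x i => // k IHk x [|i] xu ltik /=.
  rewrite -(subrKA (x ** a)) rpredD ?foldl_trunit // -(subrKA (u ** a)).
  by rewrite rpredD ?mul_trunit_l // -amulNl -amulDl trrad_mulr.
by apply: IHk => //; rewrite -(subrKA x) rpredD ?mul_trunit_r.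
Qed.

Lemma set_nth_rcons (s : seq A) i a y : (i < size s)%N ->
  set_nth 0 (rcons s y) i a = rcons (set_nth 0 s i a) y.
Proof. by elim: s i => // x s IHs [|i] //= lti; rewrite IHs. Qed.

Lemma set_nth_size (s : seq A) a y : set_nth 0 (rcons s y) (size s) a = rcons s a.
Proof. by elim: s => //= x s ->. Qed.

(* Trace of the commutator of phi with left multiplication by x_1 ... x_m. *)
Lemma trL_leibniz m : leibniz_derivation mul m.+2 phi ->
  forall s, size s = m.+1 ->
  \sum_(i < m.+1) trL (lprod mul (set_nth 0 s i (phi (nth 0 s i)))) = 0.
Proof.
move=> [_ phiD] s sz.
have s0 : s != [::] by case: s sz.
have si0 i a : set_nth 0 s i a != [::] by case: (s) sz i => // ? ? _ [].
rewrite -raddf_sum /= /trL linear_sum /=.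
suff -> : \sum_(i < m.+1) lmulL (lprod mul (set_nth 0 s i (phi (nth 0 s i)))) =
   ((phi \o lmulL (lprod mul s)) - (lmulL (lprod mul s) \o phi))%VF.
  by rewrite linearB /= lftraceC subrr.
apply/lfunP => v; rewrite add_lfunE opp_lfunE !comp_lfunE !lmulLE sum_lfunE.
rewrite -lprod_rcons // phiD ?size_rcons ?sz // [in RHS]big_ord_recr /=.
rewrite nth_rcons sz ltnn eqxx -sz set_nth_size lprod_rcons // addrK.
apply: eq_bigr => i _; have lti := ltn_ord i.
by rewrite nth_rcons lti set_nth_rcons // lprod_rcons // lmulLE.
Qed.

Lemma trL_eq0 m : leibniz_derivation mul m.+2 phi -> forall x, trL x = 0.
Proof.
move=> phiD; have := trL_leibniz phiD.
case: m phiD => [|m] [_ phiD] trD.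
  (* For order 2, trL(phi y) = 0 for all y; take y to be the preimage of x. *)
  move=> x; have := trD [:: phi^-1%VF x] erefl.
  by rewrite big_ord1 /= lker0_lfunVK.
have trN x : x \in trrad -> trL x = 0 by case/trrad_nil.
have Nphi x : x \in trrad -> phi x \in trrad.
  move=> Nx; apply/trradP => y.
  (* Terms where phi hits a later factor still start with x, so they lie in the radical; the
     remaining one is phi(x)y modulo the radical. *)
  have := trD [:: x, y & nseq m u]; rewrite /= size_nseq => /(_ erefl).
  rewrite big_ord_recl /= big1 ?addr0 => [|i _]; last first.
    by rewrite trN // foldl_trrad.
  by move=> <-; apply/esym/eqP; rewrite -subr_eq0 -linearB /= trN // foldl_trunit.
have phiN : (phi @: trrad)%VS = trrad.
  apply/eqP; rewrite eqEdim limg_dim_eq ?leqnn ?andbT; last by rewrite (eqP phi_inj) capv0.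
  by apply/subvP => _ /memv_imgP[x Nx ->]; apply: Nphi.
suff Nu : u \in trrad by move=> x; rewrite -uE; apply/trradP.
suff: phi u \in (phi @: trrad)%VS.
  by case/memv_imgP => x Nx /(lker0P phi_inj) ->.
rewrite phiN; pose xs := nseq m.+3 u.
(* Let n = [m.+3]. Since u^n is u modulo the radical, which phi preserves, phi(u^n) is phi(u); the
   Leibniz rule makes it n phi(u). *)
have lN : phi (lprod mul xs) - phi u \in trrad.
  by rewrite -linearB; apply: Nphi; exact: (foldl_trunit u m.+2).
have rN : phi (lprod mul xs) - phi u *+ m.+3 \in trrad.
  rewrite phiD ?size_nseq // -[in X in _ - X](card_ord m.+3) -sumr_const -sumrB.
  apply: memv_suml => i _; rewrite nth_nseq ltn_ord.
  case: i => -[|i] /= lti; first exact: (foldl_trunit (phi u) m.+2).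
  by apply: (@foldl_trunit_set u (phi u) m.+2 i); rewrite ?subrr ?mem0v.
(* The difference is (n - 1) phi(u), and n - 1 = [m.+2] is invertible in [F]. *)
have := rpredB lN rN; rewrite opprB addrC subrKA mulrS [phi u + _]addrC addrK.
rewrite -scaler_nat => /(memvZ m.+2%:R^-1).
by rewrite scalerA mulVf ?natr_neq0 // scale1r.
Qed.

End LeibnizDerivation.

(** Once [trL] vanishes identically, [trL_rpow_eq0] applies to every x. *)
Lemma leibniz_nil m phi : leibniz_derivation mul m.+2 phi -> bijective phi ->
  forall x, exists k, iter k sqr x = 0.
Proof.
move=> phiD phi_bij.
pose f : 'End(A) := linfun (HB.pack_for {linear A -> A} phi
  (GRing.isLinear.Build F A A *:%R phi phiD.1)).
have fE : f =1 phi := lfunE _.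
have f_inj : lker f == 0%VS by apply/lker0P => x y; rewrite !fE; apply: bij_inj.
have fD : leibniz_derivation mul m.+2 f.
  split=> [a x y|xs sz]; first by rewrite linearP.
  by rewrite fE phiD.2 //; apply: eq_bigr => i _; rewrite fE.
have [u uE] := exists_trunit => x.
by apply: (trL_rpow_eq0 _).2 => k; apply: trL_eq0 f_inj uE _ fD _.
Qed.

End Trace.
End Alternative.
End BilinearMul.

Theorem theorem2p1 (F : fieldType) (A : vectType F) (mul : A -> A -> A) :
  [pchar F] =i pred0 ->
  bilinear_mul mul ->
  alternative mul ->
  (nilpotent_alg mul <->
   exists (n : nat) (phi : A -> A),
     (2 <= n)%N /\ leibniz_derivation mul n phi /\ bijective phi).
Proof.
move=> charF mulB altA; split=> [[s [s_gt0 prod0]]|[n [phi [n_gt1 [phiD phi_bij]]]]].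
  have lprod0 := nilpotent_lprod_eq0 mulB s_gt0 prod0.
  (* The order [s.+1] is at least 2 even when s = 1; both sides of the Leibniz rule are zero. *)
  exists s.+1, id; split=> //; split; last by exists id.
  split=> // xs sz; rewrite lprod0 // big1 // => i _.
  by rewrite lprod0 // size_set_nth sz; apply/maxn_idPr.
case: n n_gt1 phiD => [|[|m]] // _ phiD.
exact: (nil_nilpotent mulB altA (leibniz_nil mulB altA charF phiD phi_bij)).
Qed.
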